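(* Let $\mathcal{F}$ be a finite union-closed family of sets with $\emptyset \notin \mathcal{F}$, let $n = |\bigcup_{A\in\mathcal{F}} A|$ and $m = |\mathcal{F}|$. If the height number satisfies $H(\mathcal{F}) \le 3$ or $H(\mathcal{F}) \ge n-1$, then there exists an element $x$ which belongs to more than half of the sets of $\mathcal{F}$, i.e. $|\{A\in\mathcal{F} : x\in A\}| > m/2$.
   Context: A union-closed family is a finite family $\mathcal{F}$ of finite sets such that $A\cup B\in\mathcal{F}$ whenever $A,B\in\mathcal{F}$. Height decomposition: let $\pi_1$ be the set of inclusion-minimal members of $\mathcal{F}$, i.e. $\pi_1=\{A\in\mathcal{F} : \forall B\in\mathcal{F},\ B\neq A \Rightarrow B\not\subseteq A\}$; inductively, while $\mathcal{F}\setminus(\pi_1\cup\dots\cup\pi_{i-1})$ is nonempty, let $\pi_i$ be the set of inclusion-minimal members of $\mathcal{F}\setminus(\pi_1\cup\dots\cup\pi_{i-1})$. The process stops after finitely many steps; the number of steps $H$ with $\mathcal{F}=\bigcup_{i=1}^{H}\pi_i$ is the height number $H(\mathcal{F})$. *)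

(* Defs.v *)
From HB Require Import structures.
From mathcomp Require Import all_boot finmap.

Set Implicit Arguments.
Unset Strict Implicit.
Unset Printing Implicit Defensive.

Local Open Scope fset_scope.

Definition union_closed (K : choiceType) (F : {fset {fset K}}) : Prop :=
  forall A B : {fset K}, A \in F -> B \in F -> A `|` B \in F.

Definition minimal_members (K : choiceType) (F : {fset {fset K}}) :
    {fset {fset K}} :=
  [fset A in F | [forall B : F, (val B != A) ==> ~~ (val B `<=` A)]].

(* levels_upto F i is pi_1 `|` ... `|` pi_i, where                            *)
(* pi_i = minimal_members (F `\` levels_upto F i.-1); levels that would come  *)
(* after F is exhausted are empty.                                            *)
Fixpoint levels_upto (K : choiceType) (F : {fset {fset K}}) (i : nat) :
    {fset {fset K}} :=
  if i is j.+1 then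
    levels_upto F j `|` minimal_members (F `\` levels_upto F j)
  else fset0.

Lemma minimal_members_neq0 (K : choiceType) (F : {fset {fset K}}) :
  F != fset0 -> minimal_members F != fset0.
Proof.
case/fset0Pn=> A0 A0F.
case: (arg_minnP (P := predT) (i0 := [` A0F]) (fun A : F => #|` val A|)) => //.
move=> A _ minA; apply/fset0Pn; exists (val A).
rewrite !inE /= (valP A) /=; apply/forallP=> B.
apply/implyP=> neBA; apply/negP=> sBA.
have ltBA : val B `<` val A by rewrite fproperEneq neBA sBA.
by have := fproper_ltn_card ltBA; rewrite ltnNge minA.
Qed.

Lemma minimal_members_sub (K : choiceType) (F : {fset {fset K}}) :
  minimal_members F `<=` F.
Proof. by apply/fsubsetP=> A; rewrite !inE /= => /andP[]. Qed.

Lemma levels_upto_sub (K : choiceType) (F : {fset {fset K}}) (i : nat) :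
  levels_upto F i `<=` F.
Proof.
elim: i => [|i IH] /=; first exact: fsub0set.
rewrite fsubUset IH /=.
exact: fsubset_trans (minimal_members_sub _) (fsubsetDl _ _).
Qed.

Lemma levels_upto_exhaust (K : choiceType) (F : {fset {fset K}}) :
  exists i : nat, levels_upto F i == F.
Proof.
suff H i : (levels_upto F i == F) || (i <= #|` levels_upto F i|).
  exists #|` F|; case/orP: (H #|` F|) => // le_card.
  by rewrite eqEfcard levels_upto_sub.
elim: i => [|i IH]; first by rewrite orbT.
have [eqF|neF] := eqVneq (levels_upto F i) F.
  apply/orP; left; rewrite eqEfsubset levels_upto_sub /=.
  by rewrite -{1}eqF fsubsetUl.
rewrite (negPf neF) /= in IH; apply/orP; right.
have /minimal_members_neq0/fset0Pn[A Amin] : F `\` levels_upto F i != fset0.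
  by apply: contra neF; rewrite fsetD_eq0 eqEfsubset levels_upto_sub.
apply: leq_ltn_trans IH _; apply: fproper_ltn_card.
rewrite fproperE fsubsetUl; apply/fsubsetPn; exists A.
  by rewrite inE Amin orbT.
by have /(fsubsetP (minimal_members_sub _)) := Amin; rewrite inE => /andP[].
Qed.

Definition height_number (K : choiceType) (F : {fset {fset K}}) : nat :=
  ex_minn (levels_upto_exhaust F).

(* Main.v *)
(* If H(F) >= n - 1, a chain of length n - 1 in F starts at a set of size at
   most 2, say {a, b}; then C |-> C U {a, b} injects the members missing both
   a and b into the members other than {a, b} containing both, so the more
   frequent of a and b works.
   If H(F) <= 3, then F has no chain of length 4. Let N be the set of members
   that are neither minimal nor the top U. A point x lying in all of N is
   missed by at most one member, two such members having their union in N;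
   this suffices when |F| > 2, and |F| <= 2 is immediate.
   Otherwise N has two distinct members B1, B2; a point of U outside Bj is
   missed exactly by the members below Bj, and the down-sets of B1 and B2 share
   at most one member A; if A exists, a point of A is missed by a third member
   of N. Counting U as well, one of the down-sets holds less than half of F. *)
Require Import Defs.
From HB Require Import structures.
From mathcomp Require Import all_boot finmap.
From mathcomp Require Import zify.

Local Open Scope fset_scope.

(** * Counting and unions in finite families *)

Lemma card_fset_filterC (K : choiceType) (F : {fset K}) (P : pred K) :
  (#|` [fset A in F | P A]| + #|` [fset A in F | ~~ P A]|)%N = #|` F|.
Proof.
rewrite -(cardfsID [fset A in F | P A] F).
have -> : F `&` [fset A in F | P A] = [fset A in F | P A].
  by apply/fsetP=> A; rewrite !inE /=; case: (A \in F).
have -> // : F `\` [fset A in F | P A] = [fset A in F | ~~ P A].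
by apply/fsetP=> A; rewrite !inE /=; case: (A \in F); rewrite ?andbF ?andbT.
Qed.

Lemma leq_card1_fset (K : choiceType) (F : {fset K}) :
  {in F &, forall A B, A = B} -> #|` F| <= 1.
Proof.
move=> F1; have [->|[A AF]] := fset_0Vmem F; first by rewrite cardfs0.
rewrite -(cardfs1 A); apply: fsubset_leq_card; apply/fsubsetP=> B BF.
by rewrite inE (F1 B A).
Qed.

Lemma frequent_of_few_missing (K : choiceType) (F : {fset {fset K}}) (x : K) :
  2 * #|` [fset A in F | x \notin A]| < #|` F| ->
  #|` F| < 2 * #|` [fset A in F | x \in A]|.
Proof. have := card_fset_filterC _ F (fun A => x \in A); lia. Qed.

Lemma fsubset_bigcup (K : choiceType) (F : {fset {fset K}}) (A : {fset K}) :
  A \in F -> A `<=` \bigcup_(B <- F) B.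
Proof. by move=> AF; apply: (bigfcup_sup id). Qed.

Lemma union_closed_bigcup (K : choiceType) (F : {fset {fset K}}) :
  union_closed F -> F != fset0 -> \bigcup_(A <- F) A \in F.
Proof.
move=> ucF /fset0Pn[A AF].
(* The induction runs over nonempty sequences, since the empty union is [fset0]. *)
suff H (s : seq {fset K}) : {subset s <= F} -> s != [::] ->
    \bigcup_(B <- s) B \in F.
  by apply: H => //; apply: contraTneq AF;
    rewrite -[A \in F]/(A \in enum_fset F) => ->.
elim: s => [//|B [|C s] IH] sF _; first by rewrite big_seq1 sF ?mem_head.
rewrite big_cons; apply: ucF; first by rewrite sF ?mem_head.
by apply: IH => // D Ds; rewrite sF // inE Ds orbT.
Qed.

(** * Families with a member of at most two elements *)

(** For P = {a, b}, counting gives |Fa| + |Fb| = |F| + |Fab| - |F0'|, so |F0'| < |Fab| makes the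
    larger of [Fa] and [Fb] more than half of [F]. *)
Lemma frequent_of_small_member (K : choiceType) (F : {fset {fset K}})
    (P : {fset K}) :
  union_closed F -> fset0 \notin F -> P \in F -> #|` P| <= 2 ->
  exists x : K, #|` F| < 2 * #|` [fset A in F | x \in A]|.
Proof.
move=> ucF F0 PF P2.
have [a [b Pab]] : exists a b, P = [fset a; b].
  have /fset0Pn[a aP] : P != fset0 by apply: contraNneq F0 => <-.
  have Pa1 : #|` P `\ a| <= 1 by move: P2; rewrite (cardfsD1 a P) aP.
  have [Pa0|[b bP]] := fset_0Vmem (P `\ a).
    (* A singleton is written with [b] equal to [a], so one count serves both sizes. *)
    by exists a, a; rewrite fsetUid -(fsetD1K aP) Pa0 fsetU0.
  exists a, b; rewrite -(fsetD1K aP); congr (_ `|` _).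
  by apply/eqP; rewrite eq_sym eqEfcard fsub1set bP cardfs1.
pose Fa := [fset A in F | a \in A]; pose Fb := [fset A in F | b \in A].
pose Fab := [fset A in Fa | b \in A].
pose Fa' := [fset A in F | a \notin A].
pose F0' := [fset A in Fa' | b \notin A].
have EF := card_fset_filterC _ F (fun A => a \in A).
have Ea := card_fset_filterC _ Fa (fun A => b \in A).
have Eb := card_fset_filterC _ Fb (fun A => a \in A).
have Ea' := card_fset_filterC _ Fa' (fun A => b \in A).
have Eab : [fset A in Fb | a \in A] = Fab.
  by apply/fsetP=> A; rewrite !inE /= -!andbA; congr (_ && _); rewrite andbC.
have Eb' : [fset A in Fb | a \notin A] = [fset A in Fa' | b \in A].
  by apply/fsetP=> A; rewrite !inE /= -!andbA; congr (_ && _); rewrite andbC.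
have lt0 : #|` F0'| < #|` Fab|.
  have PFab : P \in Fab by rewrite !inE /= PF Pab !inE !eqxx ?orbT.
  have injU : {in F0' &, injective (fun C => C `|` P)}.
    move=> C D; rewrite !inE /= => /andP[/andP[_ aC] bC] /andP[/andP[_ aD] bD].
    move=> /fsetP eqCD; apply/fsetP=> z; move: (eqCD z); rewrite Pab !inE.
    have [->|_] := eqVneq z a; first by rewrite (negPf aC) (negPf aD).
    have [->|_] := eqVneq z b; first by rewrite (negPf bC) (negPf bD).
    by rewrite !orbF.
  (* Strictness: the image avoids [P], as a nonempty C missing [a] and [b] is not inside [P]. *)
  rewrite (cardfsD1 P Fab) PFab add1n ltnS.
  rewrite -(card_in_imfset imfset_key injU).
  apply: fsubset_leq_card; apply/fsubsetP=> D /imfsetP[C /= CF0 ->].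
  move: CF0; rewrite !inE /= => /andP[/andP[CF aC] bC].
  rewrite ucF //= Pab !inE !eqxx !orbT !andbT -Pab.
  apply/eqP=> CP; have /fset0Pn[z zC] : C != fset0.
    by apply: contraNneq F0 => <-.
  have : z \in P by rewrite -CP inE zC.
  by rewrite Pab !inE => /orP[] /eqP zE; move: zC;
    rewrite zE ?(negPf aC) ?(negPf bC).
rewrite -/Fa -/Fa' in EF; rewrite -/Fab in Ea; rewrite Eab Eb' in Eb.
rewrite -/F0' in Ea'.
have [le|lt] := leqP #|` Fb| #|` Fa|; [exists a | exists b].
  rewrite -/Fa; lia.
rewrite -/Fb; lia.
Qed.

(** * Levels and chains *)

(** A set outside the first [i] levels strictly contains a member outside the first [i - 1]; each of
    the [i] descents costs at least one element. *)
Lemma small_below_level (K : choiceType) (F : {fset {fset K}}) (i : nat)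
    (A : {fset K}) :
  A \in F -> A \notin levels_upto F i ->
  exists2 B, B \in F & (#|` B| + i)%N <= #|` A|.
Proof.
elim: i A => [|i IH] A AF /=; first by exists A; rewrite ?addn0.
rewrite !inE /= negb_or AF andbT => /andP[AL]; rewrite AL /=.
case/forallPn=> [[B BFL]] /=; rewrite negb_imply negbK => /andP[neBA sBA].
move: BFL; rewrite inE => /andP[BL BF].
have [C CF leC] := IH B BF BL; exists C => //.
have : #|` B| < #|` A| by apply: fproper_ltn_card; rewrite fproperEneq neBA.
lia.
Qed.

(** As long as [A] has not been removed, it keeps [B] from being minimal. *)
Lemma proper_level (K : choiceType) (F : {fset {fset K}}) (i : nat)
    (A B : {fset K}) :
  A \in F -> A `<` B -> B \in levels_upto F i.+1 -> A \in levels_upto F i.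
Proof.
move=> AF ltAB; elim: i => [|i IH]; rewrite [levels_upto _ _.+1]/= inE.
  rewrite fsetD0 => Bmin; move: Bmin; rewrite !inE /= => /andP[_].
  by move/forallP/(_ [` AF]) => /=; move: ltAB;
    rewrite fproperEneq => /andP[-> ->].
case/orP=> [/IH AL|]; first by rewrite /= inE AL.
move=> Bmin; apply: contraT => AL; move: Bmin; rewrite in_fset /= => /andP[_].
have AFL : A \in F `\` levels_upto F i.+1 by rewrite in_fsetD AL.
by move/forallP/(_ [` AFL]) => /=; move: ltAB;
    rewrite fproperEneq => /andP[-> ->].
Qed.

Lemma levels_upto_full_le (K : choiceType) (F : {fset {fset K}}) (i j : nat) :
  i <= j -> levels_upto F i = F -> levels_upto F j = F.
Proof.
move=> + LF; elim: j => [|j IH]; first by rewrite leqn0 => /eqP <-.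
rewrite leq_eqVlt => /orP[/eqP <- //|/IH LjF].
by apply/eqP; rewrite eqEfsubset levels_upto_sub -[X in X `<=` _]LjF fsubsetUl.
Qed.

(** Each step down a chain lowers the level, so a fourth set would lie in the empty
    [levels_upto F 0]. *)
Lemma no_chain4 (K : choiceType) (F : {fset {fset K}}) (A B C D : {fset K}) :
  height_number F <= 3 -> A \in F -> B \in F -> C \in F -> D \in F ->
  A `<` B -> B `<` C -> ~~ (C `<` D).
Proof.
rewrite /height_number; case: ex_minnP => h /eqP LF _ h3 AF BF CF DF AB BC.
apply/negP=> CD; have L3 := levels_upto_full_le K F h 3 h3 LF.
have DL : D \in levels_upto F 3 by rewrite L3.
have /(proper_level K F 1 B C BF BC) := proper_level K F 2 C D CF CD DL.
by move/(proper_level K F 0 A B AF AB).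
Qed.

(** * Height at most three *)

Lemma frequent_of_height_le3 (K : choiceType) (F : {fset {fset K}}) :
  F != fset0 -> union_closed F -> fset0 \notin F -> height_number F <= 3 ->
  exists x : K, #|` F| < 2 * #|` [fset A in F | x \in A]|.
Proof.
move=> Fn0 ucF F0 H3.
have neF A : A \in F -> exists x, x \in A.
  by move=> AF; apply/fset0Pn; apply: contraNneq F0 => <-.
pose U := \bigcup_(A <- F) A.
have UF : U \in F by apply: union_closed_bigcup.
have subU A : A \in F -> A `<=` U by apply: fsubset_bigcup.
suff [x] : exists x, 2 * #|` [fset A in F | x \notin A]| < #|` F|.
  by move/frequent_of_few_missing; exists x.
have [m2|m3] := leqP #|` F| 2.
  (* Here F = {A, U}, possibly with A = U, and a point of [A] lies in every member. *)
  have [A AF AU] : exists2 A, A \in F & #|` F| <= #|` [fset A; U]|.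
    have [FU0|[A]] := fset_0Vmem (F `\ U).
      by exists U; rewrite // fsetUid -(fsetD1K UF) FU0 fsetU0.
    by rewrite !inE => /andP[AU AF]; exists A; rewrite // cardfs2 AU.
  have [x xA] := neF A AF; exists x.
  suff -> : [fset A in F | x \notin A] = fset0.
    by rewrite cardfs0 cardfs_gt0.
  have FAU : [fset A; U] = F.
    by apply/eqP; rewrite eqEfcard AU fsubUset !fsub1set AF UF.
  apply/fsetP=> C; rewrite !inE /= -FAU !inE.
  apply/negP=> /andP[/orP[/eqP->|/eqP->]]; first by rewrite xA.
  by rewrite (fsubsetP (subU A AF) _ xA).
pose inN B := [/\ B \in F, B != U & exists2 A, A \in F & A `<` B].
have NU B C : inN B -> C \in F -> B `<` C -> C = U.
  move=> [BF _ [A AF AB]] CF BC; apply/eqP.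
  have := no_chain4 _ _ A B C U H3 AF BF CF UF AB BC.
  by apply: contraNT => CU; rewrite fproperEneq CU subU.
have NUsub B C : inN B -> C \in F -> B `<=` C -> C = B \/ C = U.
  move=> BN CF BC; have [->|CB] := eqVneq C B; [by left | right].
  by apply: (NU B) => //; rewrite fproperEneq eq_sym CB.
(* The union misses [x], so it is not [U], and it strictly contains at least one of two distinct
   sets. *)
have unionN A B x : A \in F -> B \in F -> x \in U -> x \notin A -> x \notin B ->
    A != B -> inN (A `|` B).
  move=> AF BF xU xA xB AB; split; first exact: ucF.
    by apply: contraTneq xU => <-; rewrite inE negb_or xA.
  have [E|BAB] := eqVneq (A `|` B) A.
    by exists B => //; rewrite E fproperEneq eq_sym AB -E fsubsetUr.
  by exists A => //; rewrite fproperEneq eq_sym BAB fsubsetUl.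
pose nonmin B := [exists A : F, val A `<` B].
have inNP B : reflect (inN B) [&& B \in F, B != U & nonmin B].
  apply: (iffP and3P) => [[BF BU /existsP[A AB]]|[BF BU [A AF AB]]].
    by split=> //; exists (val A) => //; apply: valP.
  by split=> //; apply/existsP; exists [` AF].
pose N := [fset B in F | (B != U) && nonmin B].
have memN B : reflect (inN B) (B \in N) by rewrite !inE /=; apply: inNP.
have [/hasP[x xU /allP allx]|/hasPn missN] :=
    boolP (has (fun x => all (fun B : {fset K} => x \in B) N) U).
  exists x; suff : #|` [fset A in F | x \notin A]| <= 1.
    by move=> le1; apply: leq_ltn_trans m3; rewrite (leq_mul2l 2 _ 1).
  apply: leq_card1_fset => A B; rewrite !inE /= => /andP[AF xA] /andP[BF xB].
  apply/eqP; apply: contraT => AB.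
  have /memN/allx := unionN A B x AF BF xU xA xB AB.
  by rewrite inE (negPf xA) (negPf xB).
have {}missN x : x \in U -> exists2 B, inN B & x \notin B.
  by move/missN/allPn=> [B /memN BN xB]; exists B.
have [x0 x0U] := neF U UF.
have [B1 N1 _] := missN x0 x0U; have [B1F B1U _] := N1.
have [x1 x1B] := neF B1 B1F.
have [B2 N2 x1B2] := missN x1 (fsubsetP (subU _ B1F) _ x1B).
have [B2F B2U _] := N2.
pose D B := [fset A in F | A `<=` B].
have few B : inN B -> 2 * #|` D B| < #|` F| ->
    exists x, 2 * #|` [fset A in F | x \notin A]| < #|` F|.
  move=> BN ltD; have [BF BU _] := BN.
  have /fsubsetPn[x xU xB] : ~~ (U `<=` B).
    by apply: contra BU => UB; rewrite eqEfsubset UB subU.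
  exists x; apply: leq_ltn_trans ltD; rewrite leq_mul2l /=.
  apply: fsubset_leq_card; apply/fsubsetP=> C; rewrite !inE /= => /andP[CF xC].
  (* C ∪ B contains [B] and misses [x], so it equals [B]; hence [C] lies below [B]. *)
  rewrite CF; have [<-|E] := NUsub B _ BN (ucF B C BF CF) (fsubsetUl _ _).
    exact: fsubsetUr.
  by move: xU; rewrite -E inE (negPf xB) (negPf xC).
suff : (#|` D B1| + #|` D B2|)%N < #|` F|.
  move=> lt12; have [le1|lt1] := leqP #|` F| (2 * #|` D B1|).
    by apply: (few B2) => //; lia.
  exact: (few B1).
have NDF B : D B `<=` F by apply/fsubsetP=> A; rewrite !inE /= => /andP[].
(* N is an antichain, since only [U] lies strictly above a member of N. *)
have nsub B C : inN B -> inN C -> B `<=` C -> B = C.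
  move=> BN [CF CU _] BC; have [//|E] := NUsub B C BN CF BC.
  by rewrite E eqxx in CU.
have nB12 : B1 != B2 by apply: contraNneq x1B2 => <-.
have UD B : inN B -> U \notin D B.
  move=> [BF BU _]; rewrite !inE /= UF /=; apply: contra BU => UB.
  by rewrite eqEfsubset UB subU.
(* The union of two distinct common members would lie in N below both [B1] and [B2], forcing B1 =
   B2. *)
have I1 : #|` D B1 `&` D B2| <= 1.
  apply: leq_card1_fset => A A'; rewrite !inE /= => /andP[] /andP[AF A1].
  case/andP=> _ A2 /andP[] /andP[A'F A'1] /andP[_ A'2].
  apply/eqP; apply: contraT => AA'.
  have x2 : exists2 x, x \in U & x \notin B1.
    by apply/fsubsetPn; apply: contra B1U => UB; rewrite eqEfsubset UB subU.
  have [x xU xB] := x2.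
  have AN := unionN A A' x AF A'F xU (contra (fsubsetP A1 x) xB)
    (contra (fsubsetP A'1 x) xB) AA'.
  have E1 : A `|` A' = B1 by apply: nsub; rewrite // fsubUset A1.
  have E2 : A `|` A' = B2 by apply: nsub; rewrite // fsubUset A2.
  by rewrite -E1 E2 eqxx in nB12.
have := cardfsUI (D B1) (D B2).
have DU : U \notin D B1 `|` D B2 by rewrite in_fsetU negb_or !UD.
have DF : D B1 `|` D B2 `<=` F by rewrite fsubUset !NDF.
have [->|[A]] := fset_0Vmem (D B1 `&` D B2).
  have : U |` (D B1 `|` D B2) `<=` F by rewrite fsubUset fsub1set UF.
  by move/fsubset_leq_card; rewrite cardfsU1 DU cardfs0 addn0 => le <-.
rewrite in_fsetI !inE /= => /andP[/andP[AF A1] /andP[_ A2]].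
have [x xA] := neF A AF.
(* The overlap [A] is counted twice; [B3] and [U], both outside the two down-sets, more than
   compensate. *)
have [B3 N3 xB3] := missN x (fsubsetP (subU _ AF) _ xA).
have [B3F B3U _] := N3.
have B3D : B3 \notin D B1 `|` D B2.
  rewrite !inE /= B3F /= negb_or; apply/andP; split.
    apply: contra xB3 => s; rewrite (nsub _ _ N3 N1 s); exact: (fsubsetP A1).
  apply: contra xB3 => s; rewrite (nsub _ _ N3 N2 s); exact: (fsubsetP A2).
have : U |` (B3 |` (D B1 `|` D B2)) `<=` F.
  by rewrite !fsubUset !fsub1set UF B3F !NDF.
move/fsubset_leq_card; rewrite !cardfsU1 B3D in_fset1U eq_sym (negPf B3U) DU.
move=> le <-; apply: leq_trans le.
by rewrite !add1n ltnS -addn1 leq_add2l.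
Qed.

(** * From large height to a small member *)

Theorem theorem3p1 (K : choiceType) (F : {fset {fset K}})
  (F_neq0 : F != fset0)
  (F_union_closed : union_closed F)
  (F_fset0 : fset0 \notin F)
  (n : nat) (hn : n = #|` \bigcup_(A <- F) A|)
  (m : nat) (hm : m = #|` F|)
  (hH : height_number F <= 3 \/ n - 1 <= height_number F) :
  exists x : K, m < 2 * #|` [fset A in F | x \in A]|.
Proof.
subst m; case: hH => [|hn1]; first exact: frequent_of_height_le3.
(* [n - 2] is below the height: if truncated to 0, because [F] is nonempty and its height
   positive. *)
have /fsubsetPn[A AF AL] : ~~ (F `<=` levels_upto F (n - 2)).
  move: hn1; rewrite /height_number; case: ex_minnP => h /eqP Lh minh hn1.
  apply/negP=> sFL.
  have LF : levels_upto F (n - 2) == F by rewrite eqEfsubset levels_upto_sub.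
  have := minh _ LF; case: (posnP h) Lh => [-> /= F0|h0 _].
    by rewrite -F0 eqxx in F_neq0.
  lia.
(* Since |A| <= n, descending [n - 2] levels leaves at most two elements. *)
have [B BF leB] := small_below_level K F (n - 2) A AF AL.
apply: (frequent_of_small_member K F B) => //.
have := fsubset_leq_card (fsubset_bigcup K F A AF); rewrite -hn; lia.
Qed.
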